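(* Consider the linear time-varying system $\dot x=F(t)x$, where $x\in\mathbb{R}^n$ and $F:\mathbb{R}\to\mathbb{R}^{n\times n}$ is bounded and piecewise continuous for all $t\ge0$. If $F(t)$ vanishes exponentially, then every solution $x(t)$ converges, as $t\to\infty$, to a bounded (i.e. finite, constant) vector in $\mathbb{R}^n$.
   Context: ''$F(t)$ vanishes exponentially'' means that there exist constants $\alpha>0$ and $\lambda>0$ such that $\|F(t)\|\le\alpha e^{-\lambda t}$ for all $t\ge0$. *)

(* Defs.v *)
From mathcomp Require Import all_boot all_order all_algebra.
From mathcomp Require Import all_classical all_reals all_analysis.
Import Order.TTheory GRing.Theory Num.Theory.
Import numFieldNormedType.Exports.

Set Implicit Arguments.
Unset Strict Implicit.
Unset Printing Implicit Defensive.

Local Open Scope classical_set_scope.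
Local Open Scope ring_scope.

(* Only the values of f on [0, +oo[ matter: 0 is excluded from the two-sided
   conditions. *)
Definition piecewise_continuous_ge0 (R : realType) (V : normedModType R)
    (f : R -> V) : Prop :=
  [/\ forall T : R,
        finite_set [set t : R | 0 < t <= T /\ ~ {for t, continuous f}],
      forall t : R, 0 <= t -> cvg (f s @[s --> t^'+])
    & forall t : R, 0 < t -> cvg (f s @[s --> t^'-])].

(* `|F t| is the entrywise sup norm on matrices; all norms being equivalent in
   finite dimension and alpha existential, the choice of norm is immaterial. *)
Definition vanishes_exponentially (R : realType) (m n : nat)
    (F : R -> 'M[R]_(m, n)) : Prop :=
  exists alpha lambda : R, [/\ 0 < alpha, 0 < lambda &
    forall t : R, 0 <= t -> `|F t| <= alpha * expR (- lambda * t)].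

(* Solutions on [t0, +oo[ in the usual sense for a piecewise continuous F:
   x is continuous and satisfies the differential equation at every t > t0 except
   possibly at the discontinuities of F. *)
Definition ltv_solution (R : realType) (n : nat) (F : R -> 'M[R]_n) (t0 : R)
    (x : R -> 'cV[R]_n) : Prop :=
  {within `[t0, +oo[, continuous x} /\
  forall t : R, t0 < t -> {for t, continuous F} ->
    is_derive t (1 : R) x (F t *m x t).

(* Main.v *)
Require Import Defs.
From mathcomp Require Import all_boot all_order all_algebra.
From mathcomp Require Import all_classical all_reals all_analysis.
From mathcomp Require Import ring lra.
Import Order.TTheory GRing.Theory Num.Theory.
Import numFieldNormedType.Exports.
Set Implicit Arguments.
Unset Strict Implicit.
Unset Printing Implicit Defensive.
Local Open Scope classical_set_scope.
Local Open Scope ring_scope.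

(** With [V := \sum_i x_i ^ 2] and [|F t| <= alpha * exp(-lambda t)], one has
    [V' <= 2 n alpha exp(-lambda t) V], so
    [V t * exp((2 n alpha / lambda) exp(-lambda t))] is nonincreasing and the
    solution is bounded. Hence [|x_i'| <= C exp(-lambda t)] for some [C], i.e.
    [x_i -+ (C / lambda) exp(-lambda t)] are respectively nondecreasing and
    nonincreasing, and [x_i] converges. Finitely many exceptional points on
    bounded intervals do not affect these monotonicity arguments. *)

(** Induction on the exceptional points: a point inside []a, b[] splits the interval and continuity
    lets the two inequalities be chained; any other point imposes nothing. With no point left, this
    is the mean value theorem. *)
Lemma ge0_derive_le_seq (R : realType) (f : R -> R) (D : seq R) (a b : R) :
  a <= b -> {within `[a, b], continuous f} ->
  (forall t, a < t < b -> t \notin D -> derivable f t 1 /\ 0 <= 'D_1 f t) ->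
  f a <= f b.
Proof.
elim: D a b => [|c D IH] a b ab cf df.
  apply: (@ger0_derive1_le_cc _ f a b) => //.
  - by move=> t; rewrite in_itv => /df [].
  - by move=> t; rewrite in_itv derive1E => /df [].
  - by rewrite in_itv/= lexx.
  - by rewrite in_itv/= lexx ab.
have [/andP[ac cb]|cab] := boolP (a < c < b).
- apply: (@le_trans _ _ (f c)).
  + apply: IH; first exact: ltW.
      by apply: continuous_subspaceW cf; apply: subset_itvl; rewrite bnd_simp ltW.
    move=> t /andP[at' tc] tD; apply: df; first by rewrite at' (lt_trans tc).
    by rewrite inE negb_or lt_eqF.
  + apply: IH; first exact: ltW.
      by apply: continuous_subspaceW cf; apply: subset_itvr; rewrite bnd_simp ltW.
    move=> t /andP[ct tb] tD; apply: df; first by rewrite tb (lt_trans ac).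
    by rewrite inE negb_or gt_eqF.
- apply: IH => // t tab tD; apply: df => //; rewrite inE negb_or tD andbT.
  by apply: contra cab => /eqP <-.
Qed.

Lemma ge0_derive_homo (R : realType) (f : R -> R) (D : set R) (a : R) :
  (forall T, finite_set (D `&` `]a, T])) ->
  {within `[a, +oo[, continuous f} ->
  (forall t, a < t -> ~ D t -> derivable f t 1 /\ 0 <= 'D_1 f t) ->
  forall s t, a <= s -> s <= t -> f s <= f t.
Proof.
move=> finD cf df s t as' st.
have /finite_seqP[l Dl] := finD t.
apply: (@ge0_derive_le_seq _ _ l) => //.
  apply: continuous_subspaceW cf => u /=; rewrite !in_itv/= => /andP[su _].
  by rewrite andbT (le_trans as').
move=> u /andP[su ut] ul.
have au : a < u by exact: le_lt_trans su.
apply: df => // Du; move/negP: ul; apply.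
suff : [set` l] u by [].
by rewrite -Dl; split => //=; rewrite in_itv/= au ltW.
Qed.

Lemma homo_bounded_cvgy (R : realType) (f : R -> R) (a M : R) :
  (forall s t, a <= s -> s <= t -> f s <= f t) ->
  (forall t, a <= t -> f t <= M) -> cvg (f t @[t --> +oo]).
Proof.
move=> ndf fM.
(* Freezing [f] at the value [f a] to the left of [a] makes it monotone on the whole line, where
   monotone convergence applies; near [+oo] nothing has changed. *)
have : cvg (f (Num.max a t) @[t --> +oo]).
  apply/cvg_ex; eexists.
  apply: (nondecreasing_cvgr (f := fun t => f (Num.max a t))).
    move=> s t st; apply: ndf; first by rewrite le_max lexx.
    by rewrite ge_max !le_max lexx st orbT.
  by exists M => _ [t _ <-]; apply: fM; rewrite le_max lexx.
move=> /cvg_ex[l fl]; apply/cvg_ex; exists l.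
apply: cvg_trans fl; apply: near_eq_cvg; near=> t.
by rewrite max_r//; near: t; apply: nbhs_pinfty_ge; rewrite num_real.
Unshelve. all: by end_near. Qed.

Lemma is_derive_exp_scale (R : realType) (k l t : R) :
  is_derive t 1 (fun s => k * expR (l * s)) (k * l * expR (l * t)).
Proof.
have H : is_derive t 1 (expR \o (fun s => l * s)) (expR (l * t) * (l * 1)).
  apply: is_derive1_comp; exact: is_deriveZ.
rewrite (_ : (fun s => _) = k *: (expR \o (fun s => l * s)))//.
by apply: is_derive_eq; rewrite /GRing.scale/=; ring.
Qed.

Lemma continuous_exp_scale (R : realType) (k l : R) :
  continuous (fun s : R => k * expR (l * s)).
Proof.
move=> t; apply: differentiable_continuous; apply/derivable1_diffP.
by have [] := is_derive_exp_scale k l t.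
Qed.

Lemma exp_derive_cvgy (R : realType) (f : R -> R) (D : set R) (a C lambda : R) :
  0 <= C -> 0 < lambda -> (forall T, finite_set (D `&` `]a, T])) ->
  {within `[a, +oo[, continuous f} ->
  (forall t, a < t -> ~ D t ->
     derivable f t 1 /\ `|'D_1 f t| <= C * expR (- lambda * t)) ->
  cvg (f t @[t --> +oo]).
Proof.
move=> C0 l0 finD cf df.
pose g k t := k * expR (- lambda * t).
have cg k : {within `[a, +oo[, continuous g k}.
  exact/continuous_subspaceT/continuous_exp_scale.
have g0 k t : 0 <= k -> 0 <= g k t by move=> k0; rewrite mulr_ge0 ?expR_ge0.
have dg (k t : R) : derivable (g k) t 1 /\
    'D_1 (g k) t = - (lambda * k * expR (- lambda * t)).
  have dgt := is_derive_exp_scale k (- lambda) t.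
  by split; [exact: ex_derive | rewrite derive_val; ring].
(* With this [K] the derivative of [g K] is exactly [- C * expR (- lambda * t)], which dominates
   ['D_1 f] in absolute value. *)
pose K := C / lambda.
have K0 : 0 <= K by rewrite divr_ge0// ltW.
have lK : lambda * K = C by rewrite /K mulrCA divff ?mulr1// gt_eqF.
have ndfB s t : a <= s -> s <= t -> (f - g K) s <= (f - g K) t.
  apply: (ge0_derive_homo finD) => [|u au Du]; first exact: within_continuousB.
  have [dfu fu] := df _ au Du; have [dgu gu] := dg K u.
  split; first exact: derivableB.
  by rewrite deriveB// gu; move: fu; rewrite ler_norml lK; lra.
have nifD s t : a <= s -> s <= t -> (- (f + g K)) s <= (- (f + g K)) t.
  apply: (ge0_derive_homo finD) => [|u au Du].
    by move=> u; apply: cvgN; exact: within_continuousD.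
  have [dfu fu] := df _ au Du; have [dgu gu] := dg K u.
  split; first by apply: derivableN; exact: derivableD.
  rewrite deriveN; last exact: derivableD.
  by rewrite deriveD// gu; move: fu; rewrite ler_norml lK; lra.
have ndgN s t : a <= s -> s <= t -> (- g K) s <= (- g K) t.
  apply: (ge0_derive_homo finD) => [u|u au Du]; first by apply: cvgN; exact: cg.
  have [dgu gu] := dg K u; split; first exact: derivableN.
  rewrite deriveN// gu opprK mulr_ge0 ?expR_ge0//.
  by rewrite mulr_ge0// ltW.
(* The upper bound comes from the other combination: [f - g K <= f + g K] since [g K] is
   nonnegative, and [f + g K] never exceeds its value at [a]. *)
have fgcvg : cvg ((f - g K) t @[t --> +oo]).
  apply: (@homo_bounded_cvgy _ _ a (f a + g K a)) => // t at'.
  have := nifD _ _ (lexx a) at'; have := g0 K t K0.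
  by rewrite !fctE; lra.
have gcvg : cvg ((- g K) t @[t --> +oo]).
  apply: (@homo_bounded_cvgy _ _ a 0) => // t at'.
  by have := g0 K t K0; rewrite !fctE; lra.
rewrite (_ : f = (f - g K) - (- g K)); last by rewrite opprK subrK.
exact: is_cvgB.
Qed.

(** The matrix norm is a maximum over finitely many entries, and a filter is stable under finite
    intersections. *)
Lemma cvg_mxP (R : realType) (T : Type) (G : set_system T) {FG : Filter G}
    (m n : nat) (M : T -> 'M[R]_(m, n)) (l : 'M[R]_(m, n)) :
  (forall i j, M t i j @[t --> G] --> l i j) -> M t @[t --> G] --> l.
Proof.
move=> Ml; apply/cvgrPdist_le => /= e e0; near=> t.
rewrite /Num.Def.normr/= mx_normrE (bigmax_le _ (ltW e0))//= => i _.
rewrite !mxE/=.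
move: i; near: t; apply: filter_forall => /= i.
exact: ((cvgrPdist_le _ _).1 (Ml i.1 i.2)).
Unshelve. all: by end_near. Qed.

Lemma ler_mx_norm_coord (R : realType) (m n : nat) (A : 'M[R]_(m, n)) i j :
  `|A i j| <= `|A|.
Proof.
rewrite [leRHS]/Num.Def.normr/= mx_normrE.
exact: (le_bigmax _ (fun ij : 'I_m * 'I_n => `|A ij.1 ij.2|) (i, j)).
Qed.

Lemma is_derive_coord (R : realType) (m n : nat) (M : R -> 'M[R]_(m, n))
    (A : 'M[R]_(m, n)) (t : R) i j :
  is_derive t 1 M A -> is_derive t 1 (fun s => M s i j) (A i j).
Proof.
move=> [dM <-]; rewrite derive_mx// mxE; apply/derivableP.
by move/derivable_mxP : dM.
Qed.

Lemma quadratic_form_le (R : realType) (n : nat) (A : 'M[R]_n) (v : 'cV[R]_n)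
    (e : R) : (forall i j, `|A i j| <= e) ->
  \sum_i v i 0 * (A *m v) i 0 <= n%:R * e * \sum_i v i 0 ^+ 2.
Proof.
move=> Ae.
(* AM-GM: [v_i A_ij v_j <= e (v_i ^ 2 + v_j ^ 2) / 2] *)
apply: (@le_trans _ _
    (\sum_i \sum_j (e / 2 * v i 0 ^+ 2 + e / 2 * v j 0 ^+ 2))).
  apply: ler_sum => i _; rewrite mxE mulr_sumr; apply: ler_sum => j _.
  have := Ae i j; rewrite ler_norml => /andP[Al Au].
  (* Writing [p], [q] for the two coordinates and [A] for the entry, [(e - A)(p + q)^2 + (e + A)(p -
     q)^2 = 2e(p^2 + q^2) - 4Apq]. *)
  have := mulr_ge0 (_ : 0 <= e - A i j) (sqr_ge0 (v i 0 + v j 0)).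
  have := mulr_ge0 (_ : 0 <= e + A i j) (sqr_ge0 (v i 0 - v j 0)).
  by rewrite -lerBlDl sub0r Al subr_ge0 Au => /(_ isT) + /(_ isT); nra.
(* Equality holds here: each square is counted [n] times with weight [e / 2] in each of the two
   halves. *)
rewrite le_eqVlt; apply/orP; left; apply/eqP.
under eq_bigr do rewrite big_split/= sumr_const card_ord -mulr_sumr.
rewrite big_split/= sumr_const card_ord sumrMnl -mulr_sumr.
by field.
Qed.

Lemma exp_gronwall_bounded (R : realType) (V : R -> R) (D : set R)
    (a k lambda : R) :
  0 <= k -> 0 < lambda -> (forall T, finite_set (D `&` `]a, T])) ->
  {within `[a, +oo[, continuous V} -> (forall t, 0 <= V t) ->
  (forall t, a < t -> ~ D t ->
     derivable V t 1 /\ 'D_1 V t <= k * expR (- lambda * t) * V t) ->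
  exists M, forall t, a <= t -> V t <= M.
Proof.
move=> k0 l0 finD cV V0 dV.
pose g t := expR (k / lambda * expR (- lambda * t)).
have cg : continuous g.
  move=> t; apply: continuous_comp; first exact: continuous_exp_scale.
  exact: continuous_expR.
have dg (t : R) : is_derive t 1 g (g t * - (k * expR (- lambda * t))).
  rewrite (_ : - _ = k / lambda * - lambda * expR (- lambda * t)).
    have du := is_derive_exp_scale (k / lambda) (- lambda) t.
    exact: (@is_derive1_comp _ expR).
  by field; rewrite gt_eqF.
have g1 t : 1 <= g t.
  by rewrite -expR0 ler_expR mulr_ge0 ?expR_ge0// divr_ge0// ltW.
exists (V a * g a) => t at'.
have : (- (V * g)) a <= (- (V * g)) t.
  apply: (ge0_derive_homo finD) => // [|u au Du].
    move=> u; apply: cvgN; apply: cvgM; first exact: cV.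
    exact: (continuous_subspaceT cg).
  have [dVu Vu] := dV _ au Du; have [dgu gu] := dg u.
  split; first by apply: derivableN; exact: derivableM.
  rewrite deriveN; last exact: derivableM.
  rewrite deriveM// gu /GRing.scale/=.
  by have := g1 u; nra.
rewrite !fctE lerN2; apply: le_trans.
by rewrite -[leLHS]mulr1 ler_wpM2l.
Qed.

Theorem lemma2 (R : realType) (n : nat) (F : R -> 'M[R]_n)
    (F_bounded : [bounded F t | t in `[0, +oo[ ])
    (F_pc : piecewise_continuous_ge0 F)
    (F_exp : vanishes_exponentially F)
    (t0 : R) (t0_ge0 : 0 <= t0)
    (x : R -> 'cV[R]_n) (x_sol : ltv_solution F t0 x) :
  exists l : 'cV[R]_n, x t @[t --> +oo] --> l.
Proof.
have [finF _ _] := F_pc; have [alpha [lambda [alpha0 lambda0 Fle]]] := F_exp.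
have [cx dx] := x_sol.
(* [D] may contain negative times, but only its trace on []t0, T]] counts, and [0 <= t0] places that
   trace among the positive discontinuities. *)
pose D := [set t : R | ~ {for t, continuous F}].
have finD T : finite_set (D `&` `]t0, T]).
  apply: sub_finite_set (finF T) => t [/= Dt]; rewrite in_itv/= => /andP[t0t tT].
  by split => //; rewrite tT (le_lt_trans t0_ge0).
have dxi t i : t0 < t -> ~ D t ->
    is_derive t 1 (fun s => x s i 0) ((F t *m x t) i 0).
  by move=> t0t /contrapT Ft; apply: is_derive_coord; exact: dx.
have cxi i : {within `[t0, +oo[, continuous (fun s => x s i 0)}.
  move=> t; apply: (@continuous_comp (subspace _) _ _ x (fun A : 'cV_n => A i 0)).
    exact: cx.
  exact: coord_continuous.
have Fij t i j : t0 < t -> `|F t i j| <= alpha * expR (- lambda * t).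
  move=> t0t; apply: le_trans (Fle _ _); first exact: ler_mx_norm_coord.
  by rewrite (le_trans t0_ge0)// ltW.
(* The sum of squares replaces the sup norm because it is differentiable wherever [x] is. *)
pose V := \sum_(i < n) (fun t => x t i 0) ^+ 2.
have VE t : V t = \sum_i x t i 0 ^+ 2 by rewrite /V fct_sumE.
have [M VM] : exists M, forall t, t0 <= t -> V t <= M.
  (* The 2 comes from differentiating squares, [n%:R * alpha] from [quadratic_form_le] with
     [e := alpha * expR (- lambda * t)]. *)
  apply: (@exp_gronwall_bounded _ V D _ (2 * n%:R * alpha) lambda) => //.
  - by rewrite !mulr_ge0// ltW.
  - rewrite /V; elim/big_ind : _ => [t|f g cf cg|i _ t].
    + exact: cvg_cst.
    + exact: within_continuousD.
    + by apply: cvgM; exact: cxi.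
  - by move=> t; rewrite VE sumr_ge0// => i _; rewrite sqr_ge0.
  - move=> t t0t Dt.
    have dV : is_derive t 1 V (\sum_i 2 * (x t i 0 * (F t *m x t) i 0)).
      apply: is_derive_sum => i; have dxti := dxi t i t0t Dt.
      by apply: is_derive_eq; rewrite /GRing.scale/=; ring.
    split; first exact: ex_derive.
    rewrite derive_val -mulr_sumr VE -!mulrA ler_pM2l// !mulrA -(mulrA n%:R).
    by apply: quadratic_form_le => i j; exact: Fij.
(* A square root is avoided through [|y| <= 1 + y^2]. *)
have xM t i : t0 <= t -> `|x t i 0| <= 1 + M.
  move=> t0t; have := VM t t0t; rewrite VE (bigD1 i)//= => xiM.
  have : 0 <= \sum_(j < n | j != i) x t j 0 ^+ 2.
    by rewrite sumr_ge0// => j _; rewrite sqr_ge0.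
  by rewrite ler_norml; nra.
have xcvg i : cvg (x t i 0 @[t --> +oo]).
  (* A coordinate of [F t *m x t] has [n] terms, each at most
     [alpha * expR (- lambda * t) * (1 + M)]. The sign of [1 + M] is read off from [xM] at [t0]. *)
  apply: (@exp_derive_cvgy _ _ D t0 (n%:R * alpha * (1 + M)) lambda) => //.
    rewrite !mulr_ge0// ?(ltW alpha0)// (le_trans _ (xM t0 i (lexx _)))//.
  move=> t t0t Dt; have dxti := dxi t i t0t Dt; split; first exact: ex_derive.
  rewrite derive_val mxE; apply: (le_trans (ler_norm_sum _ _ _)).
  apply: (@le_trans _ _ (\sum_(j < n) alpha * expR (- lambda * t) * (1 + M))).
    apply: ler_sum => j _; rewrite normrM ler_pM ?normr_ge0 ?Fij//.
    by apply: xM; exact: ltW.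
  by rewrite sumr_const card_ord -mulr_natl; lra.
exists (\col_i lim (x t i 0 @[t --> +oo])).
by apply: cvg_mxP => i j; rewrite mxE ord1.
Qed.
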